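(* Let $G$ be a locally compact second countable unimodular group with a fixed Haar measure $m_G$, and let $(X,\mu,Y)$ and $(W,\nu,Z)$ be transverse $G$-spaces. For every concrete transverse $G$-factor $\phi_o:(X,\mu,Y)\to(W,\nu,Z)$ it holds that $$\phi_{o*}\mu_Y=\nu_Z .$$ Therefore, if there exists a transverse $G$-factor $(X,\mu,Y)\to(W,\nu,Z)$, then $\iota_\mu(Y)=\iota_\nu(Z)$.
   Context: A Borel $G$-space is a standard Borel space $X$ with a jointly Borel action $G\times X\to X$, $(g,x)\mapsto g.x$. For $Y\subseteq X$ and $x\in X$ put $Y_x=\{g\in G: g.x\in Y\}$. A subset of $G$ is locally finite if it meets every compact set in a finite set. A transverse $G$-space $(X,\mu,Y)$ consists of a Borel $G$-space $X$, a $G$-invariant Borel probability measure $\mu$ on $X$, and a locally integrable cross section $Y$, i.e. a Borel set $Y\subseteq X$ such that $G.Y$ (a Borel set) is $\mu$-conull, $Y_x$ is locally finite for all $x\in G.Y$, and $\int_X|Y_x\cap K|\,d\mu(x)<\infty$ for every compact $K\subset G$. The transverse measure $\mu_Y$ on $Y$ is given by $\mu_Y(f)=\int_X\sum_{g\in Y_x}f(g.x)w(g)\,d\mu(x)$ for Borel $f:Y\to[0,+\infty]$, where $w:G\to[0,+\infty]$ is any Borel function with $\int_G w\,dm_G=1$; it does not depend on $w$. The intensity is $\iota_\mu(Y)=\mu_Y(Y)$. Transverse measures are regarded, via extension by zero, as measures on the ambient space; any $\mu$-conull $G$-invariant Borel set meets $Y$ in a $\mu_Y$-conull set. A $G$-factor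 $\phi:(X,\mu)\to(W,\nu)$ is a Borel map $\phi:X\to W$ with $\phi_*\mu=\nu$ and, for every $g\in G$, $\phi(g.x)=g.\phi(x)$ for $\mu$-a.e. $x$. A transverse $G$-factor $\phi:(X,\mu,Y)\to(W,\nu,Z)$ is a $G$-factor with $Y_x=Z_{\phi(x)}$ for $\mu$-a.e. $x$. A concrete transverse $G$-factor $\phi_o:(X,\mu,Y)\to(W,\nu,Z)$ consists of a $\mu$-conull $G$-invariant Borel set $X_o\subseteq X$, a Borel map $\phi_o:X_o\to W$ with $\phi_{o*}\mu=\nu$ and $\phi_o(g.x)=g.\phi_o(x)$ for all $(g,x)\in G\times X_o$, and a cross section $Y_o\subseteq X_o$ measure equivalent to $Y$ such that $(Y_o)_x=Z_{\phi_o(x)}$ for every $x\in X_o$ (equivalently, $Y_o=\phi_o^{-1}(Z)$). Here $Y_o$ and $Y$ are measure equivalent if $(Y_o)_x=Y_x$ for $\mu$-a.e. $x\in X$. *)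

(* Defs.v *)
Set Warnings "-notation-overridden,-notation-incompatible-prefix".
From HB Require Import structures.
From mathcomp Require Import all_boot all_order all_algebra.
From mathcomp Require Import all_classical all_reals all_analysis.
From mathcomp Require Import measurable_realfun.

Set Implicit Arguments.
Unset Strict Implicit.
Unset Printing Implicit Defensive.

Import Order.TTheory GRing.Theory Num.Theory.

Local Open Scope classical_set_scope.
Local Open Scope ring_scope.
Local Open Scope ereal_scope.

(* Topological groups, not necessarily abelian. The base point carries no
   information (a group is nonempty); it is there because measurable types are
   pointed in the library. *)
HB.mixin Record isTopologicalGroup G & Group G & PointedTopological G := {
  mulg_continuous : continuous (fun p : G * G => (p.1 * p.2)%g) ;
  invg_continuous : continuous (fun g : G => (g^-1)%g)
}.

#[short(type="topologicalGroupType")]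
HB.structure Definition TopologicalGroup :=
  {G of Group G & PointedTopological G & isTopologicalGroup G}.

Notation borel T := (g_sigma_algebraType (@open T)).

(* As usual, locally compact groups are Hausdorff. *)
Record lcsc_group (G : topologicalGroupType) : Prop := {
  lcsc_hausdorff : hausdorff_space G ;
  lcsc_locally_compact : locally_compact [set: G] ;
  lcsc_second_countable : @second_countable G
}.

(* Nonzero left-invariant Borel measures finite on compact sets. On a locally
   compact second countable group such a measure is automatically regular. *)
Record haar_measure (R : realType) (G : topologicalGroupType)
    (m : {measure set (borel G) -> \bar R}) : Prop := {
  haar_left_invariant : forall (g : G) (A : set (borel G)), measurable A ->
    m ((fun h : G => (g * h)%g) @^-1` A) = m A ;
  haar_compact : forall K : set G, compact K -> m K < +oo ;
  haar_neq0 : m setT != 0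
}.

Definition unimodular (R : realType) (G : topologicalGroupType) : Prop :=
  forall m : {measure set (borel G) -> \bar R}, haar_measure m ->
    forall (g : G) (A : set (borel G)), measurable A ->
      m ((fun h : G => (h * g)%g) @^-1` A) = m A.

#[short(type="completeMetricType")]
HB.structure Definition CompleteMetric (R : numDomainType) :=
  {T of Complete T & Metric R T}.

(* Borel isomorphic to a Polish space P: f is a bijection that identifies the
   measurable subsets of X with the Borel subsets of P. *)
Definition standard_borel (R : realType) d (X : measurableType d) : Prop :=
  exists (P : completeMetricType R) (f : X -> P),
    [/\ exists2 D : set P, countable D & dense D,
        bijective f &
        forall A : set X, measurable A <-> measurable (f @` A : set (borel P))].

Record borel_gspace (R : realType) (G : topologicalGroupType) d
    (X : measurableType d) := BorelGSpace {
  act :> G -> X -> X ;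
  gspace_standard : standard_borel R X ;
  act1 : forall x, act 1%g x = x ;
  actM : forall g h x, act (g * h)%g x = act g (act h x) ;
  measurable_act :
    measurable_fun setT (fun p : borel G * X => act p.1 p.2)
}.

Definition conull (R : realType) d (X : measurableType d)
    (mu : {measure set X -> \bar R}) (A : set X) : Prop :=
  mu.-negligible (~` A).

Definition locally_finite (G : topologicalType) (S : set G) : Prop :=
  forall K : set G, compact K -> finite_set (S `&` K).

Section TransverseSpaces.
Context {R : realType} {G : topologicalGroupType} {d} {X : measurableType d}.
Variable a : borel_gspace R G X.
Implicit Types (mu : {measure set X -> \bar R}) (Y : set X).

(* Y_x *)
Definition return_set Y (x : X) : set G := [set g | Y (a g x)].

(* G.Y *)
Definition saturation Y : set X := [set a g y | g in [set: G] & y in Y].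

Definition invariant_set Y : Prop := forall g x, Y x -> Y (a g x).

Definition invariant_measure mu : Prop :=
  forall (g : G) (A : set X), measurable A -> mu (a g @^-1` A) = mu A.

(* The Borel measurability of G.Y is not required: it follows from the other
   conditions (Lusin-Novikov), and conull only asks that the complement be
   contained in a measurable null set. *)
Record cross_section mu Y : Prop := {
  cross_section_measurable : measurable Y ;
  cross_section_conull : conull mu (saturation Y) ;
  cross_section_locally_finite :
    forall x, saturation Y x -> locally_finite (return_set Y x)
}.

Definition locally_integrable mu Y : Prop :=
  forall K : set G, compact K ->
    \int[mu]_x counting (return_set Y x `&` K) < +oo.

Record transverse_space (mu : probability X R) Y : Prop := {
  transverse_invariant : invariant_measure mu ;
  transverse_cross_section : cross_section mu Y ;
  transverse_locally_integrable : locally_integrable mu Y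
}.

(* mu_Y(f), computed with the weight w. Only the values of f on Y matter, so
   this is the extension by zero of mu_Y to the ambient space X. *)
Definition transverse_measure mu Y (w : G -> \bar R) (f : X -> \bar R) :
    \bar R :=
  \int[mu]_x (\esum_(g in return_set Y x) (f (a g x) * w g)%E)%R.

Definition intensity mu Y (w : G -> \bar R) : \bar R :=
  transverse_measure mu Y w (fun x => (\1_Y x)%:E).

Definition measure_equivalent mu Y Y' : Prop :=
  {ae mu, forall x, return_set Y x = return_set Y' x}.

End TransverseSpaces.

(* The functions w admissible in the definition of the transverse measure. *)
Record weight (R : realType) (G : topologicalGroupType)
    (m : {measure set (borel G) -> \bar R}) (w : borel G -> \bar R) : Prop := {
  weight_measurable : measurable_fun setT w ;
  weight_ge0 : forall g, 0 <= w g ;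
  weight_integral : \int[m]_g w g = 1
}.

Section Factors.
Context {R : realType} {G : topologicalGroupType}.
Context {d} {X : measurableType d} {d'} {W : measurableType d'}.
Variables (a : borel_gspace R G X) (mu : probability X R) (Y : set X).
Variables (b : borel_gspace R G W) (nu : probability W R) (Z : set W).

Record g_factor (phi : X -> W) : Prop := {
  factor_measurable : measurable_fun setT phi ;
  factor_pushforward :
    forall B, measurable B -> pushforward mu phi B = nu B ;
  factor_equivariant : forall g, {ae mu, forall x, phi (a g x) = b g (phi x)}
}.

Record transverse_factor (phi : X -> W) : Prop := {
  transverse_factor_factor : g_factor phi ;
  transverse_factor_return :
    {ae mu, forall x, return_set a Y x = return_set b Z (phi x)}
}.

(* The map phi is defined on Xo: its values outside Xo are irrelevant. *)
Record concrete_transverse_factor (Xo : set X) (phi : X -> W) (Yo : set X) :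
    Prop := {
  concrete_domain_measurable : measurable Xo ;
  concrete_domain_conull : conull mu Xo ;
  concrete_domain_invariant : invariant_set a Xo ;
  concrete_measurable : measurable_fun Xo phi ;
  concrete_pushforward :
    forall B, measurable B -> mu (Xo `&` phi @^-1` B) = nu B ;
  concrete_equivariant : forall g x, Xo x -> phi (a g x) = b g (phi x) ;
  concrete_cross_section : cross_section a mu Yo ;
  concrete_sub_domain : Yo `<=` Xo ;
  concrete_equivalent : measure_equivalent a mu Yo Y ;
  concrete_return :
    forall x, Xo x -> return_set a Yo x = return_set b Z (phi x)
}.

End Factors.

(* Main.v *)
Require Import Defs.
Set Warnings "-notation-overridden,-notation-incompatible-prefix".
Set Warnings "-redundant-canonical-projection".
From HB Require Import structures.
From mathcomp Require Import all_boot all_order all_algebra.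
From mathcomp Require Import all_classical all_reals all_analysis.
From mathcomp Require Import measurable_realfun.

(** The transverse measure of [f] with weight [w] integrates over the space
the sum of [f (g z) w(g)] over the return set of [z]. Along a factor map the
return sets of [x] and of [phi x] agree almost everywhere and [phi] intertwines
the actions, so the sum attached to [x] is the sum attached to [phi x]. Since
[phi] carries [mu] to [nu], the two transverse measures computed with the same
weight agree. For the intensity the summand is [w(g)] alone, so that
equality of return sets is all that is needed and a mere transverse factor
suffices. Two issues remain.

Measurability. The sum over the return set of [z] is an uncountable operation,
and it is shown to be measurable up to a null set ([ae_measurable_esum]). With
the cells of finer and finer finite Borel partitions of [G], a sum over [G] is
the supremum of finite sums of suprema over cells ([esum_separating]), and a
supremum over [G] is governed by projections of measurable subsets of [G x W]
along [G]. Such projections differ from measurable sets by null sets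
([measurable_projection]): every measurable subset of [G x W] is the result of
a Souslin operation on rectangles with a compact side in [G]; by compactness
its projection is the result of a Souslin operation on measurable sets, to
which the argument of Szpilrajn-Marczewski with measurable hulls applies.

Independence of the weight. The incidence set of the pairs [(g, z)] with [g z]
in [Z] carries the Campbell measure [M], which counts the points of the fibres
and integrates the count over [z] ([integral_campbell]); the transverse measure
is the [M]-integral of [f (g z) w(g)]. Local integrability makes [M]
sigma-finite and invariance of [nu] makes the functional
[L(u) = \int f (g z) u(g) dM] invariant under right translations of [u]. The
uniqueness argument for Haar measure then applies: by Tonelli, and because [m]
is left invariant, [L(u) m(v) = L(v) \int u(h^-1) dm(h)]
([right_invariant_tonelli]). Taking first [L = m], which is right invariant by
unimodularity, shows that [m] is invariant under inversion, so that in general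
[L(u) m(v) = L(v) m(u)], and weights are exactly the functions of [m]-integral
one. *)

Set Implicit Arguments.
Unset Strict Implicit.
Unset Printing Implicit Defensive.

Import Order.TTheory GRing.Theory Num.Theory.

Local Open Scope classical_set_scope.
Local Open Scope ring_scope.
Local Open Scope ereal_scope.

(** * Second countable locally compact spaces *)

Lemma countable_base (T : ptopologicalType) : @second_countable T ->
  exists2 U : nat -> set T, (forall n, open (U n)) &
    forall (x : T) V, nbhs x V -> exists n, U n x /\ U n `<=` V.
Proof.
move=> [B cB [oB bB]]; have B0 : B !=set0.
  by have [V [BV _] _] := bB point setT filterT; exists V.
have [B0'|/surjfunPex[f fB]] := pfcard_geP cB.
  by move: B0 => /set0P; rewrite B0' eqxx.
exists f => [n|x V xV]; first by apply: oB; rewrite fB; exists n.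
have [W [BW Wx] WV] := bB x V xV.
by move: BW; rewrite fB => -[n _ fn]; exists n; rewrite fn.
Qed.

Section LocallyCompact.
Context {T : ptopologicalType}.
Hypothesis hT : hausdorff_space T.
Hypothesis lcT : locally_compact [set: T].
Hypothesis scT : @second_countable T.

Definition sigma_compact (A : set T) :=
  exists2 K : nat -> set T, (forall n, compact (K n)) & A = \bigcup_n K n.

(** Compact closures of basic open sets that fit inside [U] cover [U], because a
locally compact Hausdorff space is regular. *)
Lemma open_sigma_compact (U : set T) : open U -> sigma_compact U.
Proof.
move=> oU; have [V oV bV] := countable_base scT.
pose good n := compact (closure (V n)) /\ closure (V n) `<=` U.
exists (fun n => if `[< good n >] then closure (V n) else set0).
  by move=> n; case: asboolP => [[]//|_]; exact: compact0.
apply/seteqP; split => [x Ux|x [n _]]; last by case: asboolP => // -[_]; exact.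
have [C] := lcT (I : [set: T] x); rewrite withinET => xC [cC clC].
have [W xW WU] := compact_regular hT cC xC (open_nbhs_nbhs (conj oU Ux)).
have [n [Vx VWC]] := bV x (W `&` C) (filterI xW xC).
have gn : good n; last by exists n => //; case: asboolP => // _; exact: subset_closure.
split; last by apply: subset_trans WU; apply: closureS => y /VWC[].
apply: (subclosed_compact _ cC); first exact: closed_closure.
by rewrite [X in _ `<=` X](closure_id C).1//; apply: closureS => y /VWC[].
Qed.

Lemma closed_sigma_compact (F : set T) : closed F -> sigma_compact F.
Proof.
move=> cF; have [K cK KT] := open_sigma_compact openT.
exists (fun n => K n `&` F) => [n|]; first exact: compact_closedI.
by rewrite -setI_bigcupl -KT setTI.
Qed.

End LocallyCompact.

(** * Souslin operation on rectangles with a compact side *)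

Section Analytic.
Context {T : ptopologicalType} {d} {W : measurableType d}.

Definition agree (m : nat) (s t : nat -> nat) :=
  forall i, (i < m)%N -> s i = t i.

(** A Souslin scheme of rectangles [fiber n s `*` base n s]. Each rectangle sees
finitely many terms of the index sequence [s] only, but how many is left free
and may depend on [s]: this keeps the bookkeeping for unions and intersections
short. *)
Record souslin_scheme := SouslinScheme {
  base : nat -> (nat -> nat) -> set W ;
  fiber : nat -> (nat -> nat) -> set T ;
  measurable_base : forall n s, measurable (base n s) ;
  compact_fiber : forall n s, compact (fiber n s) ;
  scheme_local : forall n s, exists m, forall t, agree m s t ->
    base n t = base n s /\ fiber n t = fiber n s
}.

Definition souslin_kernel (S : souslin_scheme) : set (T * W) :=
  [set x | exists s, forall n, fiber S n s x.1 /\ base S n s x.2].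

Definition analytic (B : set (T * W)) := exists S, souslin_kernel S = B.

Lemma analyticX (K : set T) (A : set W) : compact K -> measurable A ->
  analytic (K `*` A).
Proof.
move=> cK mA.
unshelve eexists (@SouslinScheme (fun _ _ => A) (fun _ _ => K)
  (fun _ _ => mA) (fun _ _ => cK) _); first by exists 0%N.
apply/seteqP; split => [[x z] /= [_ /(_ 0%N)]//|[x z] /= xz].
by exists (fun=> 0%N).
Qed.

(** The first term of the index sequence chooses the set, the remaining terms run
through its own scheme. *)
Lemma analytic_bigcup (B : nat -> set (T * W)) :
  (forall i, analytic (B i)) -> analytic (\bigcup_i B i).
Proof.
move=> /choice[S SB].
unshelve eexists (@SouslinScheme (fun n s => base (S (s 0%N)) n (s \o succn))
  (fun n s => fiber (S (s 0%N)) n (s \o succn)) _ _ _).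
- by move=> n s; exact: measurable_base.
- by move=> n s; exact: compact_fiber.
- move=> n s; have [m mP] := scheme_local (S (s 0%N)) n (s \o succn).
  by exists m.+1 => t st; rewrite -st//; apply: mP => i im; exact: st.
apply/seteqP; split => [x [s xs]|x [i _]].
  by exists (s 0%N) => //; rewrite -SB; exists (s \o succn).
by rewrite -SB => -[s xs]; exists (fun n => if n is n'.+1 then s n' else i).
Qed.

(** One index sequence encodes countably many, one for each set, through an
injective coding of pairs. *)
Lemma analytic_bigcap (B : nat -> set (T * W)) :
  (forall i, analytic (B i)) -> analytic (\bigcap_i B i).
Proof.
move=> /choice[S SB].
pose row (s : nat -> nat) (i k : nat) := s (pickle (i, k)).
pose code p : nat * nat := odflt (0, 0)%N (unpickle p).
have codeK (i n : nat) : code (pickle (i, n)) = (i, n) by rewrite /code pickleK.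
unshelve eexists (@SouslinScheme
  (fun p s => base (S (code p).1) (code p).2 (row s (code p).1))
  (fun p s => fiber (S (code p).1) (code p).2 (row s (code p).1)) _ _ _).
- by move=> p s; exact: measurable_base.
- by move=> p s; exact: compact_fiber.
- move=> p s /=; case: (code p) => i n /=.
  have [m mP] := scheme_local (S i) n (row s i).
  exists (\max_(k < m) (pickle (i, nat_of_ord k)).+1) => t st.
  apply: mP => k km; apply: st.
  exact: (@leq_bigmax _ (fun k : 'I_m => (pickle (i, nat_of_ord k)).+1) (Ordinal km)).
apply/seteqP; split => [x [s xs] i _|x xB].
  rewrite -SB; exists (row s i) => n.
  by have := xs (pickle (i, n)); rewrite /souslin_kernel /= codeK.
have /choice[s sP] : forall i, exists s, forall n, fiber (S i) n s x.1 /\ base (S i) n s x.2.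
  by move=> i; have := xB i I; rewrite -SB.
exists (fun p => s (code p).1 (code p).2) => p /=; case: (code p) => i n /=.
rewrite (_ : row _ _ = s i)//; by apply/funext => k; rewrite /row codeK.
Qed.

End Analytic.

(** * Projections are measurable up to null sets *)

Section MeasurableProjection.
Context {R : realType} {T : ptopologicalType} {d} {W : measurableType d}.
Variable nu : {finite_measure set W -> \bar R}.

(** The infimum of the measures of the measurable sets containing [E] is attained,
by an intersection of a minimizing sequence. *)
Lemma measurable_hull (E : set W) : exists H, [/\ measurable H, E `<=` H &
  forall M, measurable M -> E `<=` M -> nu (H `\` M) = 0].
Proof.
pose S := [set nu A | A in [set A | measurable A /\ E `<=` A]].
have lfin : ereal_inf S \is a fin_num.
  rewrite fin_numE -ltNye -ltey; apply/andP; split.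
    by apply: (@lt_le_trans _ _ 0) => //; apply: le_ereal_inf_tmp => _ [A _ <-].
  apply: le_lt_trans (fin_num_fun_lty (fin_num_measure nu)).
  by apply: ereal_inf_lbound; exists setT => //; split.
have /choice[A AP] : forall n, exists A, [/\ measurable A, E `<=` A &
    nu A < ereal_inf S + (n.+1%:R^-1)%:E].
  move=> n; have n0 : (0 < n.+1%:R^-1 :> R)%R by rewrite invr_gt0.
  by have [_ [A [mA EA] <-] nuA] := lb_ereal_inf_adherent n0 lfin; exists A.
have mH : measurable (\bigcap_n A n).
  by apply: bigcap_measurable => // n _; have [] := AP n.
have EH : E `<=` \bigcap_n A n by move=> x Ex n _; have [_ + _] := AP n; exact.
exists (\bigcap_n A n); split => // M mM EM.
have HM : ereal_inf S <= nu (\bigcap_n A n `&` M).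
  apply: ereal_inf_lbound; exists (\bigcap_n A n `&` M) => //; split.
    exact: measurableI.
  by move=> x Ex; split; [exact: EH|exact: EM].
have Hl : nu (\bigcap_n A n) <= ereal_inf S.
  apply/lee_addgt0Pr => e e0.
  have [n ne] : exists n, (n.+1%:R^-1 < e)%R.
    have [n _ /(_ n)] := near_infty_natSinv_lt (PosNum e0).
    by move=> /(_ (leqnn n)); exists n.
  have [mA _ /ltW nuA] := AP n; apply: le_trans (le_trans nuA _); last first.
    by rewrite leeD2l// lee_fin ltW.
  by apply: le_measure; rewrite ?inE//; exact: bigcap_inf.
have fHM : nu (\bigcap_n A n `&` M) \is a fin_num.
  by apply: fin_num_measure; exact: measurableI.
move: Hl; rewrite (measureDI nu mH mM) => Hl.
apply/eqP; rewrite eq_le measure_ge0 andbT.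
by rewrite -(leeD2rE _ _ fHM) add0e; exact: le_trans HM.
Qed.

Lemma compact_bigcap (K : nat -> set T) : hausdorff_space T ->
  (forall n, compact (K n)) ->
  (forall N, exists x, forall n, (n < N)%N -> K n x) ->
  exists x, forall n, K n x.
Proof.
move=> hT cK KN.
have := cK 0%N; rewrite compact_In0 => /(_ nat setT (fun n => K 0%N `&` K n)).
case=> [||x Kx].
- by exists K => // i _; exact: compact_closed.
- move=> D _; have [x Kx] := KN (\max_(i <- finmap.enum_fset D) i).+1; exists x => n /= nD.
  by split; apply: Kx => //; rewrite ltnS; exact: (@leq_bigmax_seq _ _ _ id).
- by exists x => n; have [] := Kx n I.
Qed.

(** The argument of Szpilrajn-Marczewski. Let [E q] be the projection of the part
of the kernel reached by the index sequences that extend [q]. It is the union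
over [k] of the sets [E (rcons q k)], so the hull [H q] is covered by the hulls
[H (rcons q k)] up to a null set. Outside all these null sets a point of
[H [::]] lies in the hulls along a whole branch [s]. As [H q] was cut down to
the measurable set [F q] of points that satisfy all constraints decided by [q],
such a point lies in all the bases along [s], and finitely many fibres along
[s] always meet; by compactness they all meet, so the point is in the
projection. *)
Lemma analytic_projection (B : set (T * W)) : hausdorff_space T ->
  analytic B -> exists2 N, measurable N /\ nu N = 0 &
    measurable ([set z | exists x, B (x, z)] `\` N).
Proof.
move=> hT [S <-].
pose ext (q : seq nat) s := agree (size q) (nth 0%N q) s.
pose E q := [set z | exists x s, ext q s /\ forall n, fiber S n s x /\ base S n s z].
(* The constraint [n] is decided by [q] if all extensions of [q] see the same
   rectangle, that of [q] continued by zeros. *)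
pose dec (q : seq nat) n := forall s, ext q s ->
  base S n s = base S n (nth 0%N q) /\ fiber S n s = fiber S n (nth 0%N q).
pose active q n := (n < size q)%N /\ dec q n.
pose F q := [set z | (forall n, active q n -> base S n (nth 0%N q) z) /\
  exists x, forall n, active q n -> fiber S n (nth 0%N q) x].
have mF q : measurable (F q).
  pose c := exists x, forall n, active q n -> fiber S n (nth 0%N q) x.
  have [hc|hc] := pselect c; last first.
    by rewrite (_ : F q = set0)//; apply/seteqP; split => // z [].
  rewrite (_ : F q = \bigcap_(n in active q) base S n (nth 0%N q)).
    by apply: bigcap_measurableType => n _; exact: measurable_base.
  by apply/seteqP; split => [z []|z].
have EF q : E q `<=` F q.
  move=> z [x [s [qs xz]]]; split => [n [_ /(_ s qs)[<- _]]|].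
    by have [] := xz n.
  by exists x => n [_ /(_ s qs)[_ <-]]; have [] := xz n.
have /choice[H HP] q : exists H, [/\ measurable H, E q `<=` H, H `<=` F q &
    forall M, measurable M -> E q `<=` M -> nu (H `\` M) = 0].
  have [H [mH EH Hmin]] := measurable_hull (E q).
  exists (H `&` F q); split=> [|z Ez|z []//|M mM EM].
  - exact: measurableI.
  - by split; [exact: EH|exact: EF].
  - apply: (subset_measure0 _ _ _ (Hmin M mM EM)).
    + by apply: measurableD => //; exact: measurableI.
    + exact: measurableD.
    + by move=> z [[Hz _] Mz].
pose Nq q := H q `\` \bigcup_k H (rcons q k).
have mH q : measurable (H q) by have [] := HP q.
have mNq q : measurable (Nq q).
  by apply: measurableD => //; exact: bigcupT_measurable.
have Nq0 q : nu (Nq q) = 0.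
  have [_ _ _ ] := HP q; apply; first exact: bigcupT_measurable.
  move=> z [x [s [qs xz]]]; exists (s (size q)) => //.
  have [_ + _ _] := HP (rcons q (s (size q))); apply.
  exists x, s; split => // i; rewrite size_rcons ltnS leq_eqVlt nth_rcons.
  by case/orP => [/eqP ->|iq]; [rewrite ltnn eqxx|rewrite iq; exact: qs].
pose N := \bigcup_n Nq (CodeSeq.decode n).
have mN : measurable N.
  by apply: bigcupT_measurable => n; exact: mNq.
exists N.
  split => //; apply/negligibleP => //; apply: negligible_bigcup => n.
  by apply/negligibleP; [exact: mNq|exact: Nq0].
rewrite (_ : _ `\` N = H [::] `\` N); first exact: measurableD.
apply/seteqP; split => z [].
  move=> [x [s xz]] Nz; split => //; have [_ + _ _] := HP [::]; apply.
  by exists x, s.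
move=> Hz Nz; split => //.
have /choice[f fP] q : exists k, H q z -> H (rcons q k) z.
  have [Hq|] := pselect (H q z); last by move=> nH; exists 0%N => /nH.
  apply: contrapT => nH; apply: Nz; exists (CodeSeq.code q) => //; rewrite CodeSeq.codeK.
  by split => // -[k _ Hk]; apply: nH; exists k.
(* Following [f] from the empty sequence gives a branch along which all hulls
   contain [z]. *)
pose sq := fix sq n := if n is n'.+1 then rcons (sq n') (f (sq n')) else [::].
pose s n := f (sq n).
have sqE n : sq n = mkseq s n by elim: n => //= n IH; rewrite mkseqS -IH.
have Hs n : H (mkseq s n) z by rewrite -sqE; elim: n => //= n; exact: fP.
have Fs n : F (mkseq s n) z by have [_ _ + _] := HP (mkseq s n); apply.
have agr n : agree n s (nth 0%N (mkseq s n)) by move=> i il; rewrite nth_mkseq.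
have actP n : exists m, forall k, (m <= k)%N -> [/\ active (mkseq s k) n,
    base S n (nth 0%N (mkseq s k)) = base S n s &
    fiber S n (nth 0%N (mkseq s k)) = fiber S n s].
  have [m mP] := scheme_local S n s.
  exists (maxn n.+1 m) => k; rewrite geq_max => /andP[nk mk].
  have sk : agree m s (nth 0%N (mkseq s k)).
    by move=> i im; apply: agr; exact: leq_trans mk.
  have [-> ->] := mP _ sk; split => //; split; first by rewrite size_mkseq.
  move=> t; rewrite /ext size_mkseq => kt.
  have [-> ->] : base S n t = base S n s /\ fiber S n t = fiber S n s.
    apply: mP => i im; rewrite sk//; apply: kt; exact: leq_trans mk.
  by have [-> ->] := mP _ sk.
have {actP}[m mP] := choice actP.
have [x xP] : exists x, forall n, fiber S n s x.
  have cS n : compact (fiber S n s) by exact: compact_fiber.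
  apply: (compact_bigcap hT cS) => L.
  have [_ [x xP]] := Fs (\max_(n < L) m n); exists x => n nL.
  have [|an _ <-] := mP n (\max_(n < L) m n); last exact: xP.
  exact: (@leq_bigmax _ (fun n : 'I_L => m n) (Ordinal nL)).
exists x, s => n; split => //=.
by have [an <- _] := mP n (m n) (leqnn _); have [+ _] := Fs (m n); apply.
Qed.

End MeasurableProjection.

Section BorelAnalytic.
Context {R : realType} {T : ptopologicalType} {d} {W : measurableType d}.
Hypothesis hT : hausdorff_space T.
Hypothesis lcT : locally_compact [set: T].
Hypothesis scT : @second_countable T.

Let bianalytic : set (set (T * W)) := [set B | analytic B /\ analytic (~` B)].

Let bianalytic_sigma : sigma_algebra setT bianalytic.
Proof.
have analytic0 : analytic (set0 : set (T * W)).
  rewrite -(@setX0 T W set0); apply: analyticX => //; exact: compact0.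
have analyticT : analytic (setT : set (T * W)).
  have [K cK TK] := open_sigma_compact hT lcT scT openT.
  rewrite -setXTT TK setX_bigcupl; apply: analytic_bigcup => i; exact: analyticX.
split; first by split=> //; rewrite setC0.
- by move=> A [aA aCA]; rewrite setTD; split => //; rewrite setCK.
- move=> F FP; split; first by apply: analytic_bigcup => i; have [] := FP i.
  by rewrite setC_bigcup; apply: analytic_bigcap => i; have [] := FP i.
Qed.

(** Complements are not available for analytic sets, so the induction over the
generated sigma-algebra runs with the sets that are analytic together with their
complement. Open and closed subsets of [T] are both sigma-compact, which starts
the induction. *)
Lemma measurable_analytic (B : set (borel T * W)) : measurable B ->
  analytic (B : set (T * W)).
Proof.
move=> mB; suff [] : bianalytic B by [].
move: B mB; apply: smallest_sub => //.
have [K cK TK] := open_sigma_compact hT lcT scT openT.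
move=> _ [[A mA <-]|[A mA <-]]; rewrite setTI; last first.
  have aA (C : set W) : measurable C -> analytic ([set x : T * W | C x.2]).
    move=> mC; rewrite (_ : [set x | _] = \bigcup_i (K i `*` C)).
      by apply: analytic_bigcup => i; exact: analyticX.
    by rewrite -setX_bigcupl -TK setTX.
  by split; [exact: (aA A mA)|exact: (aA _ (measurableC mA))].
have sA (C : set T) : sigma_compact C -> analytic ([set x : T * W | C x.1]).
  move=> [L cL ->]; rewrite (_ : [set x | _] = \bigcup_i (L i `*` setT)).
    by apply: analytic_bigcup => i; exact: analyticX.
  by rewrite -setX_bigcupl setXT.
pose C : set (set T) := [set S | bianalytic (fst @^-1` S)].
suff : C A by [].
have : <<s @open T >> `<=` C; last exact.
apply: (@smallest_sub _ (sigma_algebra setT) (@open T)); last first.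
  move=> U oU; split; first exact: (sA U (open_sigma_compact hT lcT scT oU)).
  by apply: (sA (~` U)); apply: closed_sigma_compact => //; exact: open_closedC.
have [b0 bC bU] := bianalytic_sigma; split.
- by rewrite /C/= preimage_set0.
- by move=> S CS; rewrite /C/= setTD preimage_setC -setTD; exact: bC.
- by move=> F CF; rewrite /C/= preimage_bigcup; exact: bU.
Qed.

Theorem measurable_projection (nu : {finite_measure set W -> \bar R})
    (B : set (borel T * W)) : measurable B ->
  exists2 N, measurable N /\ nu N = 0 &
    measurable ([set z | exists x, B (x, z)] `\` N).
Proof. by move=> mB; apply: analytic_projection => //; exact: measurable_analytic. Qed.

End BorelAnalytic.

(** * Sums over fibres are measurable up to null sets *)

Section EsumSeparating.
Context {R : realType} {T : pointedType}.
Variable U : nat -> set T.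
Hypothesis sepU : forall x y, x <> y -> exists n, U n x <> U n y.

(** The cell of the [n]-th partition that contains [x], as the list of the sets
among the first [n] to which [x] belongs. *)
Definition cell n (x : T) : n.-tuple bool := [tuple `[< U i x >] | i < n].

Lemma cell_separates (s : seq T) : exists n, {in s &, injective (cell n)}.
Proof.
have /choice[i iP] (p : T * T) : exists n, p.1 <> p.2 -> U n p.1 <> U n p.2.
  have [p12|/sepU[n Un]] := pselect (p.1 = p.2); last by exists n.
  by exists 0%N.
exists (\max_(p <- [seq (x, y) | x <- s, y <- s]) (i p).+1) => x y xs ys xy.
apply: contrapT => nxy; apply: (iP (x, y) nxy) => /=.
have pP : (x, y) \in [seq (x, y) | x <- s, y <- s] by exact: allpairs_f.
have ip := @leq_bigmax_seq _ _ xpredT (fun p => (i p).+1) _ pP isT.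
have := congr1 (fun t => tnth t (Ordinal ip)) xy.
rewrite !tnth_mktuple/= => e; apply/propext.
by split => h; apply/asboolP; [rewrite -e|rewrite e]; exact/asboolP.
Qed.

Let sum_cell n (a : T -> \bar R) x :
  \sum_(t : n.-tuple bool) (if cell n x == t then a x else 0) = a x.
Proof.
rewrite -big_mkcond/= (eq_bigl (pred1 (cell n x))); first by rewrite big_pred1_eq.
by move=> t; rewrite [RHS]eq_sym.
Qed.

(** A finite set of points falls into distinct cells of a fine enough partition,
so that its sum is at most the sum over the cells of the suprema; conversely the
supremum over a cell is at most the sum over that cell. *)
Lemma esum_separating (a : T -> \bar R) : (forall x, 0 <= a x) ->
  \esum_(x in setT) a x = ereal_sup (range (fun n =>
    \sum_(t : n.-tuple bool)
      ereal_sup (range (fun x => if cell n x == t then a x else 0)))).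
Proof.
move=> a0; apply/eqP; rewrite eq_le; apply/andP; split.
  apply: ge_ereal_sup => _ [F [finF _] <-].
  have [n inj] := cell_separates (finmap.enum_fset (fset_set F)).
  apply: (@le_trans _ _ (\sum_(t : n.-tuple bool)
      ereal_sup (range (fun x => if cell n x == t then a x else 0)))); last first.
    by apply: ereal_sup_ubound; exists n.
  rewrite fsbig_finite//=.
  under eq_bigr => x _ do rewrite -(sum_cell n a x).
  rewrite exchange_big/=; apply: lee_sum => t _.
  have [/hasP[x xF /eqP xt]|/hasPn nt] := boolP (has (fun x => cell n x == t)
      (finmap.enum_fset (fset_set F))).
    rewrite (big_rem x)//= xt eqxx big_seq big1 ?adde0.
      by apply: ereal_sup_ubound; exists x => //; rewrite xt eqxx.
    move=> y; rewrite (mem_rem_uniq _ (finmap.fset_uniq _)) => /andP[/= yx yF].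
    case: eqP => // yt; move: yx; rewrite (inj y x) ?eqxx//.
    by rewrite yt.
  rewrite big_seq big1; last by move=> x /nt/negbTE ->.
  apply: (@le_trans _ _ (if cell n point == t then a point else 0)).
    by case: ifP.
  by apply: ereal_sup_ubound; exists point.
apply: ge_ereal_sup => _ [n _ <-].
apply: (@le_trans _ _ (\sum_(t : n.-tuple bool)
    \esum_(x in setT) (if cell n x == t then a x else 0))); last first.
  rewrite -esum_sum; last by move=> x t _ _; case: ifP.
  by apply: le_esum => x _; rewrite sum_cell.
apply: lee_sum => t _; apply: ge_ereal_sup => _ [x _ <-].
apply: esum_ge; exists [set x]; first by split.
by rewrite fsbig_set1.
Qed.

End EsumSeparating.

Section AeMeasurable.
Context {R : realType} {d} {W : measurableType d}.
Variable nu : {measure set W -> \bar R}.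
Implicit Types F : W -> \bar R.

(** Measurability up to a null set is phrased with an actual exceptional set, so
that countably many functions can share one. *)
Definition ae_measurable F := exists2 N, measurable N /\ nu N = 0 &
  measurable_fun (~` N) F.

Lemma null_bigcup (I : countType) (N : I -> set W) :
  (forall i, measurable (N i) /\ nu (N i) = 0) ->
  measurable (\bigcup_i N i) /\ nu (\bigcup_i N i) = 0.
Proof.
move=> NP; have mN : measurable (\bigcup_i N i).
  by apply: countable_bigcupT_measurable => // i; have [] := NP i.
split => //; pose M n := oapp N set0 (unpickle n).
apply/negligibleP => //; rewrite (_ : \bigcup_i N i = \bigcup_n M n).
  apply: negligible_bigcup => n; rewrite /M; case: unpickle => [i|]/=.
    by have [mNi Ni0] := NP i; apply/negligibleP.
  exact: negligible_set0.
apply/seteqP; split => z [i _ Ni]; last first.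
  by move: Ni; rewrite /M; case: unpickle => //= j Nj; exists j.
by exists (pickle i) => //; rewrite /M pickleK.
Qed.

Lemma ae_measurable_family (I : countType) (F : I -> W -> \bar R) :
  (forall i, ae_measurable (F i)) -> exists2 N, measurable N /\ nu N = 0 &
    forall i, measurable_fun (~` N) (F i).
Proof.
move=> FP; have /choice[N NP] i : exists N,
    (measurable N /\ nu N = 0) /\ measurable_fun (~` N) (F i).
  by have [N N0 mF] := FP i; exists N.
exists (\bigcup_i N i); first by apply: null_bigcup => i; have [] := NP i.
move=> i; have [[mN _] mF] := NP i; apply: measurable_funS mF.
  exact: measurableC.
by apply: subsetC; exact: bigcup_sup.
Qed.

End AeMeasurable.

Section EsumMeasurable.
Context {R : realType} {T : ptopologicalType} {d} {W : measurableType d}.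
Hypothesis hT : hausdorff_space T.
Hypothesis lcT : locally_compact [set: T].
Hypothesis scT : @second_countable T.
Variable nu : {finite_measure set W -> \bar R}.

(** The supremum exceeds [q] exactly on the projection of the set where [u] exceeds
[q], and rational [q] suffice. *)
Lemma ae_measurable_sup (u : borel T * W -> \bar R) : measurable_fun setT u ->
  ae_measurable nu (fun z => ereal_sup (range (fun x => u (x, z)))).
Proof.
move=> mu; pose B (q : rat) : set (borel T * W) := [set p | (ratr q)%:E < u p].
have mB q : measurable (B q).
  rewrite (_ : B q = u @^-1` `](ratr q)%:E, +oo[); last first.
    by apply/seteqP; split => p; rewrite /B/= in_itv/= andbT.
  by rewrite -[X in measurable X]setTI; apply: mu => //; exact: emeasurable_itv.
have /choice[N NP] q : exists N, (measurable N /\ nu N = 0) /\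
    measurable ([set z | exists x, B q (x, z)] `\` N).
  by have [N N0 mP] := measurable_projection hT lcT scT nu (mB q); exists N.
have [mN N0] := null_bigcup (fun q => (NP q).1).
exists (\bigcup_q N q) => // mCN.
apply: (measurability _ (ErealGenOInfty.measurableE R)) => // _ [_ [x ->] <-].
pose H q := if (x < ratr q)%R
  then ([set z | exists g, B q (g, z)] `\` N q) `\` \bigcup_q N q else set0.
rewrite (_ : _ `&` _ = \bigcup_q H q).
  apply: bigcupT_measurable_rat => q; rewrite /H; case: ifP => // _.
  by apply: measurableD => //; have [] := NP q.
apply/seteqP; split => z /=.
  rewrite in_itv/= andbT => -[Nz /ereal_sup_gt[_ [g _ <-] xu]].
  have [q xq qu] : exists2 q : rat, (x < ratr q)%R & (ratr q)%:E < u (g, z).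
    case: (u (g, z)) xu => [r| |] //.
      by rewrite lte_fin => /rat_in_itvoo[q]; rewrite in_itv/= => /andP[? ?]; exists q.
    move=> _; have /rat_in_itvoo[q] : (x < x + 1)%R by rewrite ltrDl.
    by rewrite in_itv/= => /andP[? _]; exists q => //; rewrite ltry.
  exists q => //; rewrite /H xq; split => //; split; first by exists g.
  by move=> Nq; apply: Nz; exists q.
move=> [q _]; rewrite /H; case: ifP => // xq [[[g gz] _] Nz]; split => //.
rewrite in_itv/= andbT; apply: (@lt_le_trans _ _ (u (g, z))).
  by apply: lt_trans gz; rewrite lte_fin.
by apply: ereal_sup_ubound; exists g.
Qed.

(** A countable base separates points, hence provides the partitions of
[esum_separating]. *)
Lemma ae_measurable_esum (u : borel T * W -> \bar R) : measurable_fun setT u ->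
  (forall p, 0 <= u p) ->
  ae_measurable nu (fun z => \esum_(x in [set: T]) u (x, z)).
Proof.
move=> mu u0; have [U oU bU] := countable_base scT.
have sepU (x y : T) : x <> y -> exists n, U n x <> U n y.
  move=> xy; have xC : nbhs x (~` [set y]).
    apply: open_nbhs_nbhs; split => //; apply: closed_openC.
    exact/accessible_closed_set1/hausdorff_accessible.
  have [n [Ux Un]] := bU _ _ xC; exists n => e.
  by move: Ux; rewrite e => /Un; exact.
pose v n (t : n.-tuple bool) (p : borel T * W) :=
  if cell U n p.1 == t then u p else 0.
have mv n t : measurable_fun setT (@v n t).
  apply: measurable_fun_ifT => //; apply: (measurable_fun_bool true) => //.
  rewrite setTI (_ : _ @^-1` _ = fst @^-1` [set x : borel T | cell U n x == t]); last first.
    by apply/seteqP; split.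
  rewrite -[X in measurable X]setTI; apply: measurable_fst => //.
  rewrite (_ : [set x | _] = \bigcap_(i : 'I_n)
      [set x | `[< U i x >] = tnth t i]).
    apply: fin_bigcap_measurable => // i _.
    have mU : measurable (U i : set (borel T)) by exact: sub_sigma_algebra.
    case: (tnth t i).
      by rewrite (_ : [set x | _] = U i)//; apply/seteqP; split => x /= /asboolP.
    rewrite (_ : [set x | _] = ~` U i); first exact: measurableC.
    by apply/seteqP; split => x /=; [move/negbT/asboolPn|move=> Ux; apply/negbTE/asboolPn].
  apply/seteqP; split => x /=.
    by move=> /eqP <- i _; rewrite /= tnth_mktuple.
  by move=> xt; apply/eqP/eq_from_tnth => i; rewrite tnth_mktuple; exact: xt.
pose F (i : {n : nat & n.-tuple bool}) z :=
  ereal_sup (range (fun x => v (tag i) (tagged i) (x, z))).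
have [N N0 mF] := ae_measurable_family (fun i : {n : nat & n.-tuple bool} =>
  ae_measurable_sup (mv (tag i) (tagged i))).
exists N => //.
rewrite (_ : (fun z => _) = (fun z => esups (fun n => \sum_(t : n.-tuple bool)
    F (Tagged (fun n => n.-tuple bool) t) z) 0%N)).
  by apply: measurable_fun_esups => n; apply: emeasurable_sum => t; exact: mF.
apply/funext => z; rewrite (esum_separating sepU); last by move=> x; exact: u0.
by congr ereal_sup; apply/seteqP; split => _ [n _ <-]; exists n.
Qed.

End EsumMeasurable.

(** * Lower integrals and null sets *)

Section AeIntegral.
Context {R : realType} {d} {W : measurableType d}.
Variable nu : {measure set W -> \bar R}.
Implicit Types (F : W -> \bar R) (N : set W).

Import HBNNSimple.

(** The integral of a nonnegative function is a supremum over the simple functions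
below it, and a simple function may be set to zero on a null set. The argument
applies to functions that are measurable off a null set only. *)
Lemma le_integral_off_null N F F' : measurable N -> nu N = 0 ->
  (forall z, 0 <= F z) -> (forall z, 0 <= F' z) ->
  (forall z, ~ N z -> F z <= F' z) -> \int[nu]_z F z <= \int[nu]_z F' z.
Proof.
move=> mN N0 F0 F'0 FF'; rewrite [leLHS]ge0_integralTE//.
apply: ge_ereal_sup => _ [h /= hF <-].
pose k := proj_nnsfun h (measurableC mN).
have kE z : k z = (h z * \1_(~` N) z)%R by [].
rewrite -integralT_nnsfun (_ : \int[nu]_x (h x)%:E = \int[nu]_x (k x)%:E).
  rewrite integralT_nnsfun [leRHS]ge0_integralTE//.
  apply: ereal_sup_ubound; exists k => // z; rewrite kE.
  have [Nz|Nz] := pselect (N z).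
    by rewrite indicE memNset// mulr0.
  by rewrite indicE mem_set// mulr1; apply: le_trans (hF z) (FF' z Nz).
apply: ge0_ae_eq_integral => //.
- exact/measurable_EFinP.
- exact/measurable_EFinP.
- by move=> z _; rewrite lee_fin.
- by move=> z _; rewrite lee_fin.
exists N; split => // z; apply: contra_notP => Nz _.
by congr EFin; rewrite [RHS]kE indicE mem_set// mulr1.
Qed.

Lemma eq_integral_off_null N F F' : measurable N -> nu N = 0 ->
  (forall z, 0 <= F z) -> (forall z, 0 <= F' z) ->
  (forall z, ~ N z -> F z = F' z) -> \int[nu]_z F z = \int[nu]_z F' z.
Proof.
move=> mN N0 F0 F'0 FF'.
by apply/eqP; rewrite eq_le !(le_integral_off_null mN N0)// => z /FF' ->.
Qed.

Lemma integral_off_null N F : measurable N -> nu N = 0 ->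
  (forall z, 0 <= F z) -> \int[nu]_z F z = \int[nu]_(z in ~` N) F z.
Proof.
move=> mN N0 F0; rewrite [RHS]integral_mkcond.
apply: (eq_integral_off_null mN N0) => // z; first exact: erestrict_ge0.
by move=> Nz; rewrite patchE mem_set.
Qed.

Lemma ae_integralD F F' : ae_measurable nu F -> ae_measurable nu F' ->
  (forall z, 0 <= F z) -> (forall z, 0 <= F' z) ->
  \int[nu]_z (F z + F' z) = \int[nu]_z F z + \int[nu]_z F' z.
Proof.
move=> mF mF' F0 F'0.
have mFF' (i : bool) : ae_measurable nu (if i then F else F') by case: i.
have [N [mN N0] {}mFF'] := ae_measurable_family mFF'.
rewrite !(integral_off_null mN N0)//; last by move=> z; rewrite adde_ge0.
apply: ge0_integralD => //; first exact: measurableC.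
- exact: (mFF' true).
- exact: (mFF' false).
Qed.

Lemma ae_integralZl F (r : R) : ae_measurable nu F -> (forall z, 0 <= F z) ->
  (0 <= r)%R -> \int[nu]_z (r%:E * F z) = r%:E * \int[nu]_z F z.
Proof.
move=> [N [mN N0] mF] F0 r0.
rewrite !(integral_off_null mN N0)//; last by move=> z; rewrite mule_ge0.
by apply: ge0_integralZl => //; exact: measurableC.
Qed.

Lemma ae_cvg_monotone_convergence (F : nat -> W -> \bar R) F' :
  (forall n, ae_measurable nu (F n)) -> (forall n z, 0 <= F n z) ->
  (forall z, nondecreasing_seq (F ^~ z)) ->
  (forall z, F n z @[n --> \oo] --> F' z) ->
  \int[nu]_z F n z @[n --> \oo] --> \int[nu]_z F' z.
Proof.
move=> mF F0 ndF FF'; have [N [mN N0] mFN] := ae_measurable_family mF.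
have F'0 z : 0 <= F' z by apply: cvge_to_ge (FF' z) _; exact: nearW.
rewrite (integral_off_null mN N0)//.
under eq_fun do rewrite (integral_off_null mN N0)//.
have mCN := measurableC mN.
rewrite (@eq_integral _ _ _ nu _ (fun z => limn (F ^~ z)) F'); last first.
  by move=> z _; apply/esym/cvg_lim => //; exact: FF'.
by apply: cvg_monotone_convergence => // z _; exact: ndF.
Qed.

End AeIntegral.

(** * Limits and multiples of sums of nonnegative families *)

Section EsumLimits.
Context {R : realType} {T : choiceType}.
Implicit Types (a : T -> \bar R) (D : set T).

Lemma esumZl D a (r : R) : (forall x, 0 <= a x) -> (0 <= r)%R ->
  \esum_(x in D) (r%:E * a x) = r%:E * \esum_(x in D) a x.
Proof.
have le (s : R) b : (forall x, 0 <= b x) -> (0 <= s)%R ->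
    \esum_(x in D) (s%:E * b x) <= s%:E * \esum_(x in D) b x.
  move=> b0 s0; apply: ge_ereal_sup => _ [F FD <-].
  rewrite -ge0_mule_fsumr//; apply: lee_wpmul2l; first by rewrite lee_fin.
  by apply: ereal_sup_ubound; exists F.
move=> a0; rewrite le_eqVlt => /predU1P[<-|r0].
  by rewrite mul0e esum1// => x _; rewrite mul0e.
apply/eqP; rewrite eq_le le ?(ltW r0)//=.
rewrite -[leRHS]mul1e -(mulfV (lt0r_neq0 r0)) EFinM -muleA.
apply: lee_wpmul2l; first by rewrite lee_fin ltW.
apply: le_trans (le _ _ _ _); last 2 first.
- by move=> x; rewrite mule_ge0// lee_fin ltW.
- by rewrite invr_ge0 ltW.
by apply: le_esum => x _; rewrite muleA -EFinM mulVf ?lt0r_neq0// mul1e.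
Qed.

Lemma esum_cvg D (a : nat -> T -> \bar R) a' : (forall n x, 0 <= a n x) ->
  (forall x, nondecreasing_seq (a ^~ x)) ->
  (forall x, a n x @[n --> \oo] --> a' x) ->
  \esum_(x in D) a n x @[n --> \oo] --> \esum_(x in D) a' x.
Proof.
move=> a0 nda aa'; pose b n := \esum_(x in D) a n x.
have ndb : nondecreasing_seq b by move=> m n mn; apply: le_esum => x _; exact: nda.
have a'E x : a' x = ereal_sup (range (a ^~ x)).
  have h := ereal_nondecreasing_cvgn (nda x).
  by rewrite -(cvg_lim _ h)// (cvg_lim _ (aa' x)).
suff -> : \esum_(x in D) a' x = ereal_sup (range b) by exact: ereal_nondecreasing_cvgn.
apply/eqP; rewrite eq_le; apply/andP; split; last first.
  apply: ge_ereal_sup => _ [n _ <-]; apply: le_esum => x _.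
  by rewrite a'E; apply: ereal_sup_ubound; exists n.
apply: ge_ereal_sup => _ [F [finF FD] <-]; rewrite fsbig_finite//=.
have Faa' : \sum_(x <- finmap.enum_fset (fset_set F)) a n x @[n --> \oo] -->
    \sum_(x <- finmap.enum_fset (fset_set F)) a' x.
  apply: cvg_nnesum => [x _|x _]; last exact: aa'.
  exact: nearW.
apply: (cvge_to_le Faa').
apply: nearW => n; apply: (@le_trans _ _ (b n)); last first.
  by apply: ereal_sup_ubound; exists n.
by apply: ereal_sup_ubound; exists F => //; rewrite fsbig_finite.
Qed.

End EsumLimits.

(** * The Campbell measure *)

Section Campbell.
Context {R : realType} {T : ptopologicalType} {d} {W : measurableType d}.
Hypothesis hT : hausdorff_space T.
Hypothesis lcT : locally_compact [set: T].
Hypothesis scT : @second_countable T.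
Variable nu : {finite_measure set W -> \bar R}.
Variable E : set (borel T * W).
Hypothesis mE : measurable E.
Implicit Types u v : borel T * W -> \bar R.

(** The sets [E] of interest are incidence sets of a group action, whose fibres are
the return sets. *)
Definition fibre_sum u (z : W) : \bar R :=
  \esum_(x in [set x : T | E (x, z)]) u (x, z).

Definition fibre_integral u := \int[nu]_z fibre_sum u z.

Lemma fibre_sum_ge0 u z : (forall p, 0 <= u p) -> 0 <= fibre_sum u z.
Proof. by move=> u0; apply: esum_ge0. Qed.

Lemma fibre_integral_ge0 u : (forall p, 0 <= u p) -> 0 <= fibre_integral u.
Proof. by move=> u0; apply: integral_ge0 => z _; exact: fibre_sum_ge0. Qed.

Lemma ae_measurable_fibre_sum u : measurable_fun setT u ->
  (forall p, 0 <= u p) -> ae_measurable nu (fibre_sum u).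
Proof.
move=> mu u0; rewrite (_ : fibre_sum u =
    fun z => \esum_(x in [set: T]) (u \_ E) (x, z)).
  apply: ae_measurable_esum => //.
    exact: ((measurable_restrictT u mE).1 (measurable_funS measurableT (@subsetT _ E) mu)).
  by move=> p; apply: erestrict_ge0 => q _.
apply/funext => z; rewrite /fibre_sum esum_mkcond; apply: eq_esum => x _.
by rewrite patchE.
Qed.

Lemma fibre_integralD u v : measurable_fun setT u -> measurable_fun setT v ->
  (forall p, 0 <= u p) -> (forall p, 0 <= v p) ->
  fibre_integral (fun p => u p + v p) = fibre_integral u + fibre_integral v.
Proof.
move=> mu mv u0 v0; rewrite -ae_integralD; first last.
- by move=> z; exact: fibre_sum_ge0.
- by move=> z; exact: fibre_sum_ge0.
- exact: ae_measurable_fibre_sum.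
- exact: ae_measurable_fibre_sum.
by apply: eq_integral => z _; rewrite /fibre_sum esumD.
Qed.

Lemma fibre_integralZl u (r : R) : measurable_fun setT u ->
  (forall p, 0 <= u p) -> (0 <= r)%R ->
  fibre_integral (fun p => r%:E * u p) = r%:E * fibre_integral u.
Proof.
move=> mu u0 r0; rewrite -ae_integralZl//; first last.
- by move=> z; exact: fibre_sum_ge0.
- exact: ae_measurable_fibre_sum.
by apply: eq_integral => z _; rewrite /fibre_sum esumZl.
Qed.

Lemma fibre_integral0 : fibre_integral (cst 0) = 0.
Proof. by apply: integral0_eq => z _; rewrite /fibre_sum esum1. Qed.

Lemma fibre_integral_sum (I : Type) (s : seq I) (u : I -> borel T * W -> \bar R) :
  (forall i, measurable_fun setT (u i)) -> (forall i p, 0 <= u i p) ->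
  fibre_integral (fun p => \sum_(i <- s) u i p) =
  \sum_(i <- s) fibre_integral (u i).
Proof.
move=> mu u0; elim: s => [|i s IHs].
  transitivity (fibre_integral (cst 0)); last by rewrite big_nil fibre_integral0.
  by congr fibre_integral; apply/funext => p; rewrite big_nil.
rewrite big_cons -IHs -fibre_integralD//; last 2 first.
- exact: emeasurable_sum.
- by move=> p; apply: sume_ge0 => j _; exact: u0.
by congr fibre_integral; apply/funext => p; rewrite big_cons.
Qed.

Lemma fibre_integral_cvg (u : nat -> borel T * W -> \bar R) v :
  (forall n, measurable_fun setT (u n)) -> (forall n p, 0 <= u n p) ->
  (forall p, nondecreasing_seq (u ^~ p)) ->
  (forall p, u n p @[n --> \oo] --> v p) ->
  fibre_integral (u n) @[n --> \oo] --> fibre_integral v.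
Proof.
move=> mu u0 ndu uv; apply: ae_cvg_monotone_convergence.
- by move=> n; exact: ae_measurable_fibre_sum.
- by move=> n z; exact: fibre_sum_ge0.
- by move=> z m n mn; apply: le_esum => x _; exact: ndu.
- by move=> z; apply: esum_cvg => // x; exact: ndu.
Qed.

Definition campbell (A : set (borel T * W)) : \bar R :=
  fibre_integral (EFin \o \1_A).

Let campbell0 : campbell set0 = 0.
Proof.
rewrite -[RHS]fibre_integral0; congr fibre_integral.
by apply/funext => p /=; rewrite indic0.
Qed.

Let campbell_ge0 A : 0 <= campbell A.
Proof. by apply: fibre_integral_ge0 => p; rewrite lee_fin. Qed.

Let measurable_EFin_indic (A : set (borel T * W)) : measurable A ->
  measurable_fun setT (EFin \o \1_A : _ -> \bar R).
Proof. by move=> mA; apply/measurable_EFinP/measurable_indicP. Qed.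

Let campbell_sigma_additive : semi_sigma_additive campbell.
Proof.
move=> A mA tA mUA.
rewrite (_ : (fun n => _) = fun n =>
    fibre_integral (fun p => \sum_(0 <= i < n) (\1_(A i) p)%:E)); last first.
  apply/funext => n; rewrite fibre_integral_sum// => i; exact: measurable_EFin_indic.
apply: fibre_integral_cvg.
- by move=> n; apply: emeasurable_sum => i; exact: measurable_EFin_indic.
- by move=> n p; apply: sume_ge0 => i _; rewrite lee_fin.
- by move=> p m n mn; apply: lee_sum_nneg_natr => // i _ _; rewrite lee_fin.
- move=> p; rewrite /= indic_bigcup//.
  by apply: is_cvg_nneseries => n _ _; rewrite lee_fin.
Qed.

HB.instance Definition _ := isMeasure.Build _ _ _ campbell
  campbell0 campbell_ge0 campbell_sigma_additive.

Definition campbell_measure : {measure set (borel T * W) -> \bar R} := campbell.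

Import HBNNSimple.

Lemma fibre_integral_nnsfun (h : {nnsfun (borel T * W)%type >-> R}) :
  fibre_integral (EFin \o h) = \int[campbell_measure]_p (h p)%:E.
Proof.
rewrite integralT_nnsfun sintegralE fsbig_finite//=.
rewrite (_ : EFin \o h = fun p => \sum_(r <- finmap.enum_fset (fset_set (range h)))
    (r * \1_(h @^-1` [set r]) p)%:E); last first.
  by apply/funext => p /=; rewrite [in LHS]fimfunE fsbig_finite//= sumEFin.
rewrite fibre_integral_sum; first last.
- by move=> r p; rewrite EFinM nnfun_muleindic_ge0.
- move=> r; apply/measurable_EFinP; exact: measurable_funM.
apply: eq_bigr => r _; have [r0|r0] := ltP r 0%R.
  rewrite preimage_nnfun0// measure0 mule0 -[RHS]fibre_integral0.
  by congr fibre_integral; apply/funext => p; rewrite indic0 mulr0.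
rewrite -fibre_integralZl//; first exact: measurable_EFin_indic.
by move=> p; rewrite lee_fin.
Qed.

(** Both sides agree on simple functions and are continuous along increasing
sequences. *)
Theorem integral_campbell u : measurable_fun setT u -> (forall p, 0 <= u p) ->
  \int[campbell_measure]_p u p = fibre_integral u.
Proof.
move=> mu u0; pose h := nnsfun_approx measurableT mu.
have hu p : (h n p)%:E @[n --> \oo] --> u p by exact: cvg_nnsfun_approx.
have ndh p : nondecreasing_seq (fun n => (h n p)%:E).
  by move=> m n mn; rewrite lee_fin; exact/lefP/nd_nnsfun_approx.
have mh n : measurable_fun setT (EFin \o h n) by exact/measurable_EFinP.
have h0 n p : 0 <= (h n p)%:E by rewrite lee_fin.
have lim1 := @fibre_integral_cvg (fun n => EFin \o h n) u mh h0 ndh hu.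
rewrite -(cvg_lim _ lim1)//; apply/esym/cvg_lim => //.
under eq_fun do rewrite fibre_integral_nnsfun.
rewrite (@eq_integral _ _ _ _ _ (fun p => limn (fun n => (h n p)%:E)) u); last first.
  by move=> p _; apply/esym/cvg_lim => //; exact: hu.
by apply: cvg_monotone_convergence => // p _; exact: ndh.
Qed.

End Campbell.

(** * Invariant functionals on unimodular groups *)

Section BorelMaps.

Lemma continuous_borel_measurable (T T' : ptopologicalType) (f : T -> T') :
  continuous f -> measurable_fun setT (f : borel T -> borel T').
Proof.
move=> /continuousP cf.
apply: (@measurability _ _ (borel T) (borel T') setT f (@open T') erefl).
move=> _ [V oV <-].
by rewrite setTI; apply: sub_sigma_algebra; exact: cf.
Qed.

(** An open subset of the product is a countable union of open boxes, so it belongs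
to the product of the Borel sigma-algebras. *)
Lemma continuous2_borel_measurable (T1 T2 T' : ptopologicalType)
    (f : T1 * T2 -> T') : @second_countable T1 -> @second_countable T2 ->
  continuous f -> measurable_fun setT (f : borel T1 * borel T2 -> borel T').
Proof.
move=> /countable_base[U1 oU1 bU1] /countable_base[U2 oU2 bU2] /continuousP cf.
apply: (@measurability _ _ (borel T1 * borel T2)%type (borel T') setT f (@open T') erefl).
move=> _ [V oV <-]; rewrite setTI.
pose box n m := if `[< U1 n `*` U2 m `<=` f @^-1` V >] then U1 n `*` U2 m else set0.
rewrite (_ : f @^-1` V = \bigcup_n \bigcup_m box n m).
  apply: bigcupT_measurable => n; apply: bigcupT_measurable => m.
  rewrite /box; case: ifP => _; last exact: measurable0.
  by apply: measurableX; apply: sub_sigma_algebra; [exact: oU1|exact: oU2].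
apply/seteqP; split => [[x y] fxy|x [n _ [m _]]]; last first.
  by rewrite /box; case: asboolP => // UV; exact: UV.
have : nbhs (x, y) (f @^-1` V) by apply: open_nbhs_nbhs; split => //; exact: cf.
move=> [[A B] [/= /bU1[n [Ux UA]] /bU2[m [Uy UB]]] ABV].
exists n => //; exists m => //; rewrite /box; case: asboolP => // -[] [x' y'] [/= x'U y'U].
by apply: ABV; split; [exact: UA|exact: UB].
Qed.

Lemma compact_borel_measurable (T : ptopologicalType) (K : set T) :
  hausdorff_space T -> compact K -> measurable (K : set (borel T)).
Proof.
move=> hT cK; rewrite -[K]setCK; apply: measurableC; apply: sub_sigma_algebra.
by apply: closed_openC; exact: compact_closed.
Qed.

End BorelMaps.

Section Integrals.
Context {R : realType} {d} {S : measurableType d} {d'} {S' : measurableType d'}.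
Variables (m : {measure set S -> \bar R}) (m' : {measure set S' -> \bar R}).

Lemma integral_measure_preserving (f : S -> S') (p : S' -> \bar R) :
  measurable_fun setT f ->
  (forall A, measurable A -> m (f @^-1` A) = m' A) ->
  measurable_fun setT p -> (forall s, 0 <= p s) ->
  \int[m]_s p (f s) = \int[m']_s p s.
Proof.
move=> mf fm mp p0.
have := @ge0_integral_pushforward _ _ _ _ R f mf m setT p measurableT mp
  (fun y _ => p0 y).
by rewrite preimage_setT => <-; apply: eq_measure_integral => A mA _; exact: fm.
Qed.

Lemma sigma_finite_tonelli (f : S * S' -> \bar R) :
  sigma_finite setT m -> sigma_finite setT m' ->
  measurable_fun setT f -> (forall p, 0 <= f p) ->
  \int[m]_x \int[m']_y f (x, y) = \int[m']_y \int[m]_x f (x, y).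
Proof.
move=> sm sm' mf f0.
pose M : sigma_finite_measure S R := HB.pack_for (sigma_finite_measure S R)
  (Measure.sort m) (isSigmaFinite.Build _ _ _ _ sm)
  (isSFinite.Build _ _ _ _ (sfinite_measure_sigma_finite sm)).
pose M' : sigma_finite_measure S' R := HB.pack_for (sigma_finite_measure S' R)
  (Measure.sort m') (isSigmaFinite.Build _ _ _ _ sm')
  (isSFinite.Build _ _ _ _ (sfinite_measure_sigma_finite sm')).
exact: (@fubini_tonelli _ _ _ _ _ M M' f mf f0).
Qed.

End Integrals.

Section Haar.
Context {R : realType} {G : topologicalGroupType}.
Hypothesis lcscG : lcsc_group G.
Let hG := lcsc_hausdorff lcscG.
Let lcG := lcsc_locally_compact lcscG.
Let scG := lcsc_second_countable lcscG.

Lemma measurable_mulg :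
  measurable_fun setT (fun p : borel G * borel G => ((p.1 : G) * p.2)%g : borel G).
Proof. exact: (continuous2_borel_measurable scG scG (@mulg_continuous G)). Qed.

Lemma measurable_invg : measurable_fun setT (fun g : borel G => ((g : G)^-1)%g : borel G).
Proof. exact: (continuous_borel_measurable (@invg_continuous G)). Qed.

Lemma measurable_mulgl (g : G) :
  measurable_fun setT (fun h : borel G => (g * (h : G))%g : borel G).
Proof.
apply: (measurableT_comp measurable_mulg (g := fun h : borel G => (g : borel G, h))).
exact: measurable_fun_pair.
Qed.

Lemma measurable_mulgr (g : G) :
  measurable_fun setT (fun h : borel G => ((h : G) * g)%g : borel G).
Proof.
apply: (measurableT_comp measurable_mulg (g := fun h : borel G => (h, g : borel G))).
exact: measurable_fun_pair.
Qed.

Variable m : {measure set (borel G) -> \bar R}.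
Hypothesis mH : haar_measure m.
Hypothesis m_right : forall (g : G) (A : set (borel G)), measurable A ->
  m ((fun h : G => (h * g)%g) @^-1` A) = m A.

Lemma haar_sigma_finite : sigma_finite setT m.
Proof.
have [K cK TK] := open_sigma_compact hG lcG scG openT.
exists K => // n; split; first exact: compact_borel_measurable.
exact: haar_compact mH _ (cK n).
Qed.

Lemma haar_mulgl (g : G) (p : borel G -> \bar R) : measurable_fun setT p ->
  (forall x, 0 <= p x) -> \int[m]_h p (g * (h : G))%g = \int[m]_h p h.
Proof.
move=> mp p0; apply: (integral_measure_preserving (measurable_mulgl g)) => // A.
exact: haar_left_invariant.
Qed.

Lemma haar_mulgr (g : G) (p : borel G -> \bar R) : measurable_fun setT p ->
  (forall x, 0 <= p x) -> \int[m]_h p ((h : G) * g)%g = \int[m]_h p h.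
Proof.
move=> mp p0; apply: (integral_measure_preserving (measurable_mulgr g)) => // A.
exact: m_right.
Qed.

(** Let [L(u)] be the integral of [k * u(pr)] for [M]. By left invariance of [m],
[L(u) m(v)] is the integral of [k(s) u(pr s) v(pr s * h)] over [s] and [h]. For
fixed [h], right invariance of [L] replaces it by the integral of
[k(s) u(pr s * h^-1) v(pr s)]; integrating over [h] first then separates the
two factors again. *)
Lemma right_invariant_tonelli d (S : measurableType d)
    (M : {measure set S -> \bar R}) (pr : S -> borel G) (k : S -> \bar R)
    (u v : borel G -> \bar R) :
  sigma_finite setT M -> measurable_fun setT pr ->
  measurable_fun setT k -> (forall s, 0 <= k s) ->
  (forall (h : G) p, measurable_fun setT p -> (forall x, 0 <= p x) ->
    \int[M]_s (k s * p (pr s)) = \int[M]_s (k s * p ((pr s : G) * h^-1)%g)) ->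
  measurable_fun setT u -> (forall x, 0 <= u x) ->
  measurable_fun setT v -> (forall x, 0 <= v x) ->
  \int[M]_s (k s * u (pr s)) * \int[m]_h v h =
  \int[M]_s (k s * v (pr s)) * \int[m]_h u ((h : G)^-1)%g.
Proof.
move=> sM mpr mk k0 inv mu u0 mv v0.
have mui : measurable_fun setT (fun h : borel G => u ((h : G)^-1)%g).
  exact: measurableT_comp mu measurable_invg.
have m1 : measurable_fun setT (fun q : S * borel G => pr q.1).
  exact: measurableT_comp mpr measurable_fst.
have m2 : measurable_fun setT (fun q : S * borel G => ((pr q.1 : G) * q.2)%g : borel G).
  exact: (measurableT_comp measurable_mulg (measurable_fun_pair m1 measurable_snd)).
have m3 : measurable_fun setT
    (fun q : S * borel G => ((pr q.1 : G) * (q.2 : G)^-1)%g : borel G).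
  apply: (measurableT_comp measurable_mulg (measurable_fun_pair m1 _)).
  exact: measurableT_comp measurable_invg measurable_snd.
have mk1 : measurable_fun setT (fun q : S * borel G => k q.1).
  exact: measurableT_comp mk measurable_fst.
transitivity (\int[M]_s \int[m]_h (k s * u (pr s) * v ((pr s : G) * (h : G))%g)).
  rewrite -ge0_integralZr//; last 3 first.
  - by apply: emeasurable_funM => //; exact: measurableT_comp mu mpr.
  - by move=> s _; rewrite mule_ge0.
  - exact: integral_ge0.
  apply: eq_integral => s _; rewrite ge0_integralZl//; last 2 first.
  - exact: measurableT_comp mv (measurable_mulgl _).
  - by rewrite mule_ge0.
  by rewrite haar_mulgl.
transitivity (\int[m]_h \int[M]_s (k s * u (pr s) * v ((pr s : G) * (h : G))%g)).
  apply: (@sigma_finite_tonelli _ _ _ _ _ M m (fun q : S * borel G =>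
    k q.1 * u (pr q.1) * v ((pr q.1 : G) * (q.2 : G))%g)) => //.
  - exact: haar_sigma_finite.
  - apply: emeasurable_funM; last exact: measurableT_comp mv m2.
    by apply: emeasurable_funM => //; exact: measurableT_comp mu m1.
  - by move=> q; rewrite !mule_ge0.
transitivity (\int[m]_h \int[M]_s (k s * v (pr s) * u ((pr s : G) * (h : G)^-1)%g)).
  apply: eq_integral => h _.
  under eq_integral do rewrite -muleA.
  rewrite (inv h (fun x : borel G => u x * v ((x : G) * (h : G))%g)).
  - apply: eq_integral => s _; rewrite mulgVK.
    by rewrite -muleA (muleC (u _)).
  - by apply: emeasurable_funM => //; exact: measurableT_comp mv (measurable_mulgr _).
  - by move=> x; rewrite mule_ge0.
transitivity (\int[M]_s \int[m]_h (k s * v (pr s) * u ((pr s : G) * (h : G)^-1)%g)).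
  apply/esym/(@sigma_finite_tonelli _ _ _ _ _ M m (fun q : S * borel G =>
    k q.1 * v (pr q.1) * u ((pr q.1 : G) * (q.2 : G)^-1)%g)) => //.
  - exact: haar_sigma_finite.
  - apply: emeasurable_funM; last exact: measurableT_comp mu m3.
    by apply: emeasurable_funM => //; exact: measurableT_comp mv m1.
  - by move=> q; rewrite !mule_ge0.
rewrite -ge0_integralZr//; last 3 first.
- by apply: emeasurable_funM => //; exact: measurableT_comp mv mpr.
- by move=> s _; rewrite mule_ge0.
- by apply: integral_ge0 => h _.
apply: eq_integral => s _; rewrite ge0_integralZl//; last 2 first.
- apply: (measurableT_comp mu); apply: (measurableT_comp (measurable_mulgl _)).
  exact: measurable_invg.
- by rewrite mule_ge0.
congr (_ * _).
rewrite -(haar_mulgr ((pr s : G)^-1)%g mui)//.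
by apply: eq_integral => h _; rewrite invgM invgK.
Qed.

(** The case [L = m] of [right_invariant_tonelli], with a function of integral one
as [v]. *)
Lemma haar_invg (w : borel G -> \bar R) : weight m w ->
  forall u : borel G -> \bar R, measurable_fun setT u -> (forall x, 0 <= u x) ->
  \int[m]_h u ((h : G)^-1)%g = \int[m]_h u h.
Proof.
move=> [mw w0 w1] u mu u0.
have := @right_invariant_tonelli _ (borel G) m id (cst 1) u w haar_sigma_finite
  (@measurable_id _ _ setT) (measurable_cst 1) (fun _ => lee01).
under eq_integral do rewrite mul1e.
under [in X in _ = X]eq_integral do rewrite mul1e.
rewrite w1 mule1 mul1e => <- //.
move=> h p mp p0; under eq_integral do rewrite mul1e.
under [RHS]eq_integral do rewrite mul1e.
by rewrite (haar_mulgr _ mp p0).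
Qed.

End Haar.

(** * Transverse measures *)

(** The integrand [I] need not be measurable: the integrals are lower integrals,
which do not see null sets. *)
Lemma ae_integral_measure_preserving {R : realType} {d} {S : measurableType d}
    {d'} {S' : measurableType d'} (m : {measure set S -> \bar R})
    (m' : {measure set S' -> \bar R}) (f : S -> S') (I : S -> \bar R)
    (F : S' -> \bar R) :
  measurable_fun setT f ->
  (forall A, measurable A -> m (f @^-1` A) = m' A) ->
  ae_measurable m' F -> (forall s, 0 <= F s) -> (forall s, 0 <= I s) ->
  {ae m, forall s, I s = F (f s)} -> \int[m]_s I s = \int[m']_s F s.
Proof.
move=> mf fm [N [mN N0] mF] F0 I0 [N' [mN' N'0 IF]].
have mCN := measurableC mN.
pose F' := F \_ (~` N).
have F'0 s : 0 <= F' s by exact: erestrict_ge0.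
have mF' : measurable_fun setT F' by exact: (measurable_restrictT F mCN).1.
have F'F s : ~ N s -> F' s = F s by move=> Ns; rewrite /F' patchE mem_set.
rewrite -(eq_integral_off_null mN N0 F'0 F0 F'F).
rewrite -(integral_measure_preserving mf fm mF' F'0).
have mfN : measurable (f @^-1` N) by rewrite -[X in measurable X]setTI; exact: mf.
have fN0 : m (f @^-1` N) = 0 by rewrite fm.
apply: (@eq_integral_off_null _ _ _ m (N' `|` f @^-1` N)) => //.
- exact: measurableU.
- by rewrite measureU0.
move=> s /not_orP[N's Ns]; rewrite F'F//.
by apply: contrapT => IFs; apply: N's; exact: IF.
Qed.

Lemma esum_indic_le_counting {R : realType} {T : choiceType} (D K : set T) :
  \esum_(x in D) (\1_K x)%:E <= counting (D `&` K) :> \bar R.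
Proof.
rewrite /counting; case: asboolP => [fin|_]; last exact: leey.
rewrite [leRHS](_ : _ = \esum_(x in D `&` K) 1); last first.
  by rewrite esum_fset// fsbig_finite//= card_fset_sum1 natr_sum -sumEFin.
rewrite esum_mkcondr; apply: le_esum => x _.
by rewrite indicE; case: (x \in K).
Qed.

Section WeightIndependence.
Context {R : realType} {G : topologicalGroupType} {d} {W : measurableType d}.
Hypothesis lcscG : lcsc_group G.
Let hG := lcsc_hausdorff lcscG.
Let lcG := lcsc_locally_compact lcscG.
Let scG := lcsc_second_countable lcscG.
Variables (b : borel_gspace R G W) (nu : probability W R) (Z : set W).
Hypothesis nuZ : transverse_space b nu Z.

Let hit : set (borel G * W) := [set p | Z (b p.1 p.2)].

Let measurable_hit : measurable hit.
Proof.
rewrite (_ : hit = (fun p : borel G * W => b p.1 p.2) @^-1` Z)//.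
rewrite -[X in measurable X]setTI; apply: (measurable_act b) => //.
exact: cross_section_measurable (transverse_cross_section nuZ).
Qed.

Let M := campbell_measure hG lcG scG nu measurable_hit.

Let measurable_translate (g : G) : measurable_fun setT (b g).
Proof.
apply: (measurableT_comp (measurable_act b) (g := fun z : W => (g : borel G, z))).
exact: measurable_fun_pair.
Qed.

(** Over a compact [K] the Campbell measure is at most the integral of the number
of points of the return set in [K], which is finite by local integrability. *)
Lemma campbell_sigma_finite : sigma_finite setT M.
Proof.
have [K cK TK] := open_sigma_compact hG lcG scG openT.
exists (fun n => (K n : set (borel G)) `*` [set: W]).
  by rewrite -setX_bigcupl -TK setXTT.
move=> n; have mK : measurable (K n : set (borel G)) by exact: compact_borel_measurable.
split; first exact: measurableX.
apply: le_lt_trans (transverse_locally_integrable nuZ (cK n)).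
apply: (@le_integral_off_null _ _ _ nu set0) => //.
- by move=> z; apply: fibre_sum_ge0 => p; rewrite lee_fin.
- by move=> z; rewrite /counting; case: ifP => _; rewrite ?lee_fin ?leey.
move=> z _; apply: le_trans (esum_indic_le_counting _ _).
by apply: le_esum => g _; rewrite /= !indicE in_setX in_setT andbT.
Qed.

Section Weights.
Variables (f : W -> \bar R) (mf : measurable_fun setT f) (f0 : forall z, 0 <= f z).

Let weighted (w : borel G -> \bar R) (p : borel G * W) := f (b p.1 p.2) * w p.1.

Let measurable_weighted w : measurable_fun setT w ->
  measurable_fun setT (weighted w).
Proof.
move=> mw; apply: emeasurable_funM.
  exact: measurableT_comp mf (measurable_act b).
exact: measurableT_comp mw measurable_fst.
Qed.

Lemma ae_measurable_transverse_sum (w : borel G -> \bar R) :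
  measurable_fun setT w -> (forall g, 0 <= w g) ->
  ae_measurable nu
    (fun z => (\esum_(g in return_set b Z z) (f (b g z) * w g)%E)%R).
Proof.
move=> mw w0.
apply: (@ae_measurable_fibre_sum _ _ _ _ hG lcG scG nu _ measurable_hit (weighted w)).
  exact: measurable_weighted.
by move=> p; exact: mule_ge0.
Qed.

Lemma transverse_measureE (w : borel G -> \bar R) :
  measurable_fun setT w -> (forall g, 0 <= w g) ->
  transverse_measure b nu Z w f = \int[M]_p weighted w p.
Proof.
move=> mw w0; rewrite integral_campbell//; first exact: measurable_weighted.
by move=> p; exact: mule_ge0.
Qed.

(** Replacing [z] by [h z] translates its return set by [h^-1] on the right and does
not change the integral, since [nu] is invariant. *)
Lemma transverse_measure_translate (h : G) (w : borel G -> \bar R) :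
  measurable_fun setT w -> (forall g, 0 <= w g) ->
  transverse_measure b nu Z w f =
  transverse_measure b nu Z (fun g => w ((g : G) * h^-1)%g) f.
Proof.
move=> mw w0; apply/esym.
apply: (ae_integral_measure_preserving (measurable_translate h)).
- exact: transverse_invariant nuZ h.
- exact: ae_measurable_transverse_sum.
- by move=> z; apply: esum_ge0 => g _; exact: mule_ge0.
- by move=> z; apply: esum_ge0 => g _; exact: mule_ge0.
apply: aeW => z.
rewrite (@reindex_esum _ _ _ (return_set b Z (b h z)) _ (fun g : G => (g * h)%g)).
  by apply: eq_esum => g _; rewrite actM mulgK.
split.
- by move=> g; rewrite /return_set/= actM.
- by move=> g g' _ _ /(congr1 (fun x => x * h^-1)%g); rewrite !mulgK.
- move=> g Zg; exists (g * h^-1)%g; last by rewrite mulgVK.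
  by rewrite /return_set/= -actM mulgVK.
Qed.

(** The transverse measure, as a functional of the weight, is right invariant, so
it is proportional to the Haar integral. *)
Lemma transverse_measure_weight (m : {measure set (borel G) -> \bar R}) :
  haar_measure m -> unimodular R G -> forall w w', weight m w -> weight m w' ->
  transverse_measure b nu Z w f = transverse_measure b nu Z w' f.
Proof.
move=> mH uni w w' Hw [mw' w'0 w'1].
have [mw w0 w1] := Hw.
have inv (h : G) p : measurable_fun setT p -> (forall x, 0 <= p x) ->
    \int[M]_s (f (b s.1 s.2) * p s.1) =
    \int[M]_s (f (b s.1 s.2) * p ((s.1 : G) * h^-1)%g).
  move=> mp p0; have mph : measurable_fun setT
      (fun g : borel G => p ((g : G) * h^-1)%g).
    exact: measurableT_comp mp (measurable_mulgr lcscG _).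
  have := transverse_measure_translate h mp p0.
  by rewrite !transverse_measureE.
have mfb : measurable_fun setT (fun s : borel G * W => f (b s.1 s.2)).
  exact: measurableT_comp mf (measurable_act b).
have := right_invariant_tonelli lcscG mH (uni m mH) campbell_sigma_finite
  measurable_fst mfb (fun s => f0 _) inv mw w0 mw' w'0.
rewrite (haar_invg lcscG mH (uni m mH) Hw mw w0) w1 w'1 !mule1.
by rewrite !transverse_measureE.
Qed.

End Weights.
End WeightIndependence.

Theorem proposition5p10 (R : realType) (G : topologicalGroupType)
  (G_lcsc : lcsc_group G) (G_unimodular : unimodular R G)
  (mG : {measure set (borel G) -> \bar R}) (mG_haar : haar_measure mG)
  (d : measure_display) (X : measurableType d) (a : borel_gspace R G X)
  (mu : probability X R) (Y : set X) (XmuY : transverse_space a mu Y)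
  (d' : measure_display) (W : measurableType d') (b : borel_gspace R G W)
  (nu : probability W R) (Z : set W) (WnuZ : transverse_space b nu Z)
  (w : borel G -> \bar R) (w_weight : weight mG w)
  (w' : borel G -> \bar R) (w'_weight : weight mG w') :
  (forall (Xo : set X) (phi : X -> W) (Yo : set X),
     concrete_transverse_factor a mu Y b nu Z Xo phi Yo ->
     forall f : W -> \bar R, measurable_fun setT f -> (forall z, 0 <= f z) ->
       transverse_measure a mu Y w ((f \o phi) \_ Xo) =
       transverse_measure b nu Z w' f) /\
  ((exists phi : X -> W, transverse_factor a mu Y b nu Z phi) ->
     intensity a mu Y w = intensity b nu Z w').
Proof.
have [mw w0 _] := w_weight; split.
  move=> Xo phi Yo [mXo muXo invXo mphi phi_push phi_equi _ _ YoY YoZ] f mf f0.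
  rewrite -(transverse_measure_weight G_lcsc WnuZ mf f0 mG_haar G_unimodular
    w_weight w'_weight).
  have muCXo : mu (~` Xo) = 0 by apply/negligibleP => //; exact: measurableC.
  have fphi0 x : 0 <= ((f \o phi) \_ Xo) x.
    by apply: erestrict_ge0 => y _; exact: f0.
  apply: (@ae_integral_measure_preserving _ _ _ _ _ mu nu (phi \_ Xo)).
  - exact: ((measurable_restrictT phi mXo).1 mphi).
  - move=> B mB; apply: etrans (phi_push B mB).
    have mphiB : measurable ((phi \_ Xo) @^-1` B).
      by rewrite -[X in measurable X]setTI; exact: ((measurable_restrictT phi mXo).1 mphi).
    rewrite (measureDI mu mphiB mXo) (@subset_measure0 _ _ _ mu _ (~` Xo))//.
    + rewrite add0e; congr (mu _); apply/seteqP; split => x /=.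
        by move=> [+ Xox]; rewrite patchE mem_set.
      by move=> [Xox ?]; rewrite patchE mem_set.
    + exact: measurableD.
    + exact: measurableC.
  - exact: (ae_measurable_transverse_sum G_lcsc WnuZ mf f0 mw w0).
  - by move=> z; apply: esum_ge0 => g _; exact: mule_ge0.
  - by move=> z; apply: esum_ge0 => g _; exact: mule_ge0.
  have aeXo : {ae mu, forall x, Xo x} by exact: muXo.
  have aeY : {ae mu, forall x, return_set a Yo x = return_set a Y x} by exact: YoY.
  apply: filterS2 aeXo aeY => x Xox YoYx.
  rewrite patchE mem_set// -YoZ// YoYx; apply: eq_esum => g _.
  by rewrite patchE (mem_set (invXo g x Xox)) /= phi_equi.
move=> [phi [[mphi phi_push _] phi_ret]].
have mZ := cross_section_measurable (transverse_cross_section WnuZ).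
have mf : measurable_fun setT (fun z => (\1_Z z : R)%:E).
  by apply/measurable_EFinP/measurable_indicP.
have f0 z : 0 <= (\1_Z z : R)%:E by rewrite lee_fin.
rewrite /intensity -(transverse_measure_weight G_lcsc WnuZ mf f0 mG_haar
  G_unimodular w_weight w'_weight).
apply: (ae_integral_measure_preserving mphi phi_push).
- exact: (ae_measurable_transverse_sum G_lcsc WnuZ mf f0 mw w0).
- by move=> z; apply: esum_ge0 => g _; exact: mule_ge0.
- by move=> z; apply: esum_ge0 => g _; rewrite mule_ge0// lee_fin.
apply: filterS phi_ret => x Yx; rewrite -Yx; apply: eq_esum => g Yg.
rewrite !indicE !mem_set//.
by move: Yg; rewrite Yx.
Qed.
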